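(* Assume (Denoiser) and (Contractive carry) as defined in the context, and assume $\mathcal{L}_\infty = \widetilde{\mathcal{L}}$ as functions of $\theta$. Let $W\ge 1$ be an integer dividing $J$, and let $\theta_W$ be a regular parameter with $g_W(\theta_W)=0$ at which $\mathcal{L}_\infty$ satisfies the Polyak--Łojasiewicz inequality with constant $\mu>0$, i.e. $\mathcal{L}_\infty$ is differentiable at $\theta_W$ and $\tfrac12\|\nabla\mathcal{L}_\infty(\theta_W)\|^2 \ge \mu\bigl(\mathcal{L}_\infty(\theta_W)-\inf_\theta \mathcal{L}_\infty(\theta)\bigr)$. Then $$\mathrm{KL}\bigl(p^\star\,\Vert\,p_{\theta_W}\bigr)-\inf_\theta \mathrm{KL}\bigl(p^\star\,\Vert\,p_\theta\bigr)\;\le\;\frac{B^2}{2\mu}\Bigl(\frac{J}{W}-1\Bigr)^2,\qquad B=\frac{C_L C_h}{(1-\gamma)^2}.$$ The bound decreases as $W$ grows and vanishes at $W=J$.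
   Context: Setting. $\mathcal{V}$ is a finite vocabulary containing a mask token $m$; sequences are $\mathbf{x}\in\mathcal{V}^L$; $\Omega\subseteq\{1,\dots,L\}$ is the set of response positions, and the tokens outside $\Omega$ (the prompt) are fixed non-mask tokens. $\mathcal{M}(\mathbf{x})=\{i: x^i=m\}$. $p^\star$ is a probability distribution on responses $\mathbf{x}_0^\Omega\in(\mathcal{V}\setminus\{m\})^\Omega$. The denoiser with parameter $\theta\in\mathbb{R}^P$ takes a sequence $\mathbf{x}\in\mathcal{V}^L$ and a carry $h\in\mathbb{R}^{L\times d}$ and returns $f_{\mathrm{carry}}(\mathbf{x},h)=(f_\theta(\cdot\mid\mathbf{x},h),h')$, where $f_\theta^i(\cdot\mid\mathbf{x},h)$ is a probability distribution on $\mathcal{V}$ for each position $i$ and $h'\in\mathbb{R}^{L\times d}$ is the new carry (also depending on $\theta$). Fix an integer $u\ge1$. Trajectories. Start from $\mathbf{x}_{t_0}$ (all response positions masked) and $h_0=0$. At step $j$: compute $(f_\theta(\cdot\mid\mathbf{x}_{t_j},h_j),h_{j+1})=f_{\mathrm{carry}}(\mathbf{x}_{t_j},h_j)$; let $S_j$ be the $u$ positions of $\mathcal{M}(\mathbf{x}_{t_j})$ with largest confidence $\max_{v\in\mathcal{V}}f_\theta^i(v\mid\mathbf{x}_{t_j},h_j)$ (all remaining ones if fewer than $u$), ties broken by index; then fill the positions of $S_j$ to obtain $\mathbf{x}_{t_{j+1}}$. Stop after $J$ steps, when no mask remains. The sampler fills each $i\in S_j$ independently with $x^i\sim f_\theta^i(\cdot\mid\mathbf{x}_{t_j},h_j)$;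 $p_\theta$ is the resulting distribution over responses. The teacher-forced trajectory of $\mathbf{x}_0$ instead fills $x^i=x_0^i$ for $i\in S_j$. (Denoiser) For all $\theta,\mathbf{x},h,i$: $f_\theta^i(m\mid\mathbf{x},h)=0$ and $f_\theta^i(v\mid\mathbf{x},h)>0$ for $v\ne m$; and for every fixed $\mathbf{x}$ the map $(\theta,h)\mapsto f_{\mathrm{carry}}(\mathbf{x},h)$ is real-analytic. Losses. $\mathcal{L}^{(j)}$ is the loss at step $j$ of the teacher-forced trajectory of $\mathbf{x}_0$: a positively weighted cross-entropy $w_j\sum_{i\in T_j}-\log f_\theta^i(x_0^i\mid\mathbf{x}_{t_j},h_j)$, where $w_j>0$ depends only on $\mathbf{x}_{t_j}$ and $T_j$ is $\mathcal{M}(\mathbf{x}_{t_j})$ or $S_j$. The total loss is $\mathcal{L}_\infty(\theta)=\mathbb{E}_{\mathbf{x}_0\sim p^\star}\bigl[\sum_{j<J}\mathcal{L}^{(j)}\bigr]$. The teacher-forced loss on revealed positions is $\widetilde{\mathcal{L}}(\theta)=\mathbb{E}_{\mathbf{x}_0\sim p^\star}\bigl[\sum_{j<J}\sum_{i\in S_j}-\log f_\theta^i(x_0^i\mid\mathbf{x}_{t_j},h_j)\bigr]$ along the teacher-forced trajectory. Regular parameters. $\theta$ is regular if for every $\mathbf{x}_0$ in the support of $p^\star$ and every step $j$ of its teacher-forced trajectory with $|\mathcal{M}(\mathbf{x}_{t_j})|>u$, the $u$-th largest confidence over $\mathcal{M}(\mathbf{x}_{t_j})$ is strictly larger than the $(u+1)$-th.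 Truncated gradient. For $W$ dividing $J$, the steps $0,\dots,J-1$ are split into consecutive windows of $W$ steps. At a regular $\theta$, $g_W(\theta)$ is the gradient of $\mathcal{L}_\infty$ computed with all sets $S_j$ held fixed and with the carry entering the first step of each window treated as a constant (detached), i.e. with $p_j=j\bmod W$, $$g_W(\theta)=\mathbb{E}_{\mathbf{x}_0}\sum_{j<J}\Bigl[\frac{\partial\mathcal{L}^{(j)}}{\partial\theta}+\sum_{r=1}^{p_j}\frac{\partial\mathcal{L}^{(j)}}{\partial h_j}\Bigl(\prod_{s=1}^{r-1}\frac{\partial h_{j-s+1}}{\partial h_{j-s}}\Bigr)\frac{\partial h_{j-r+1}}{\partial\theta}\Bigr].$$ All derivatives here are partial: $h_{k+1}$ is regarded as a function of $(\theta,h_k)$ and $\mathcal{L}^{(j)}$ as a function of $(\theta,h_j)$, with sequences and selected sets fixed. In particular $g_J=\nabla\mathcal{L}_\infty$. (Contractive carry) There are constants $\gamma<1$, $C_h$, $C_L$ such that for all $\theta$, every $\mathbf{x}_0$ in the support of $p^\star$ and every step $j$ of its teacher-forced trajectory, $\|\partial h_{j+1}/\partial h_j\|\le\gamma$, $\|\partial h_{j+1}/\partial\theta\|\le C_h$, $\|\partial\mathcal{L}^{(j)}/\partial h_j\|\le C_L$ (operator norms). *)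

(* Defs.v *)
From HB Require Import structures.
From mathcomp Require Import all_boot all_order all_algebra.
From mathcomp Require Import zify.
From mathcomp Require Import all_classical all_reals all_analysis.
Import Order.TTheory GRing.Theory Num.Theory.
Import numFieldNormedType.Exports.

Set Implicit Arguments.
Unset Strict Implicit.
Unset Printing Implicit Defensive.

Local Open Scope classical_set_scope.
Local Open Scope ring_scope.

Section Analysis.
Context {R : realType}.

(* Euclidean (Frobenius) norm; the library norm on matrices is the sup norm. *)
Definition l2norm {m n : nat} (A : 'M[R]_(m, n)) : R :=
  Num.sqrt (\sum_i \sum_j A i j ^+ 2).

(* The set is bounded for every linear [A] between finite-dimensional spaces,
   so that [sup] is a genuine supremum there. *)
Definition opnorm {E F : Type} (nE : E -> R) (nF : F -> R) (A : E -> F) : R :=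
  sup [set nF (A v) | v in [set v | nE v <= 1]].

Definition gradient {n : nat} (f : 'rV[R]_n -> R) (a : 'rV[R]_n) : 'rV[R]_n :=
  \row_k 'd (f : 'rV[R]_n -> R^o) a (delta_mx 0 k).

(* Around every point [a], [f] is the sum of an absolutely convergent power
   series in [x - a].  Multi-indices are functions ['I_n -> nat]; sums over all
   of them are limits of sums over the boxes {0, ..., N-1}^n, which is the
   unordered sum because of absolute convergence. *)
Definition real_analytic {n : nat} (f : 'rV[R]_n -> R) : Prop :=
  forall a : 'rV[R]_n, exists (c : ('I_n -> nat) -> R) (r : R), 0 < r /\
    forall v : 'rV[R]_n, (forall i, `|v 0 i| < r) ->
      let term N (k : {ffun 'I_n -> 'I_N}) : R :=
        c (fun i => k i : nat) * \prod_i v 0 i ^+ (k i : nat) in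
      cvgn (fun N : nat => \sum_(k : {ffun 'I_n -> 'I_N}) `|term N k|) /\
      (fun N : nat => \sum_(k : {ffun 'I_n -> 'I_N}) term N k) @ \oo
        --> f (a + v).

Definition is_distr {T : finType} (p : T -> R) : Prop :=
  (forall x, 0 <= p x) /\ \sum_x p x = 1.

(* Terms with [p x = 0] contribute 0. *)
Definition KL {T : finType} (p q : T -> R) : \bar R :=
  (\sum_(x | (0 < p x)%R)
     if q x == 0%R then +oo else (p x * ln (p x / q x))%:E)%E.

End Analysis.

(* Whole sequences represent responses: they agree with the prompt outside
   [Omega] and have no mask inside. *)
Definition is_response {V : finType} (m : V) {L : nat} (Omega : {set 'I_L})
    (prompt x : {ffun 'I_L -> V}) : bool :=
  [forall i, if i \in Omega then x i != m else x i == prompt i].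

Record model (R : realType) := Model {
  vocab : finType;
  mask : vocab;
  len : nat;
  Omega : {set 'I_len};
  (* only the values outside [Omega] matter *)
  prompt : {ffun 'I_len -> vocab};
  promptP : forall i, i \notin Omega -> prompt i != mask;
  nparam : nat;
  width : nat;
  fcarry : 'rV[R]_nparam -> {ffun 'I_len -> vocab} -> 'M[R]_(len, width) ->
           ('I_len -> vocab -> R) * 'M[R]_(len, width);
  fcarry_distr : forall theta x h i, is_distr ((fcarry theta x h).1 i);
  (* number of positions filled at each step *)
  nfill : nat;
  nfill_gt0 : (0 < nfill)%N;
  pstar : {x : {ffun 'I_len -> vocab} | is_response mask Omega prompt x} -> R;
  pstar_distr : is_distr pstar;
  (* loss weight w_j, a function of the sequence at step j *)
  weight : {ffun 'I_len -> vocab} -> R;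
  weight_gt0 : forall x, 0 < weight x;
  (* whether T_j is the set of all masked positions, or S_j *)
  loss_on_all : nat -> bool }.

Section Model.
Context {R : realType} (M : model R).
Local Notation V := (vocab M).
Local Notation L := (len M).
Local Notation sequence := {ffun 'I_L -> V}.
Local Notation param := 'rV[R]_(nparam M).
Local Notation carry := 'M[R]_(L, width M).

Definition response :=
  {x : sequence | is_response (mask M) (Omega M) (prompt M) x}.

Definition probs (theta : param) (x : sequence) (h : carry) : 'I_L -> V -> R :=
  (fcarry theta x h).1.

Definition next_carry (theta : param) (x : sequence) (h : carry) : carry :=
  (fcarry theta x h).2.

Definition masked (x : sequence) : {set 'I_L} := [set i | x i == mask M]%SET.

Definition confidence (p : 'I_L -> V -> R) (i : 'I_L) : R :=
  \big[Num.max/0]_(v : V) p i v.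

Definition precedes (p : 'I_L -> V -> R) (i k : 'I_L) : bool :=
  (confidence p k < confidence p i) ||
  (confidence p k == confidence p i) && (i <= k)%N.

Definition select (p : 'I_L -> V -> R) (x : sequence) : {set 'I_L} :=
  [set i in take (nfill M) (sort (precedes p) (enum (masked x)))]%SET.

Definition init : sequence :=
  [ffun i => if i \in Omega M then mask M else prompt M i].

(* The number J of steps, i.e. #|Omega| / nfill rounded up; see
   [num_steps_stop] below. *)
Definition num_steps : nat := ((#|Omega M| + (nfill M).-1) %/ nfill M)%N.

Definition tf_step (theta : param) (y : sequence) (s : sequence * carry) :
    sequence * carry :=
  let S := select (probs theta s.1 s.2) s.1 in
  ([ffun i => if i \in S then y i else s.1 i], next_carry theta s.1 s.2).

Definition tf_state theta y j : sequence * carry :=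
  iter j (tf_step theta y) (init, 0).

Definition tf_seq theta y j : sequence := (tf_state theta y j).1.
Definition tf_carry theta y j : carry := (tf_state theta y j).2.
Definition tf_select theta y j : {set 'I_L} :=
  select (probs theta (tf_seq theta y j) (tf_carry theta y j))
         (tf_seq theta y j).

Lemma num_steps_stop theta (y : response) j :
  (#|masked (tf_seq theta (val y) j)| == 0%N) = (num_steps <= j)%N.
Proof.
have u0 := nfill_gt0 M.
have offO i k : i \notin Omega M -> tf_seq theta (val y) k i = prompt M i.
  move=> iO; elim: k => [|k IH]; first by rewrite ffunE (negbTE iO).
  rewrite /tf_seq /tf_state iterS -/(tf_state _ _ k) ffunE IH; case: ifP => // _.
  by have /forallP/(_ i) := valP y; rewrite (negbTE iO) => /eqP.
have card_sel p x : #|select p x| = minn (nfill M) #|masked x|.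
  rewrite /select cardsE; move: (sort _ _) (sort_uniq (precedes p) (enum (masked x)))
    (size_sort (precedes p) (enum (masked x))) => s us ss.
  have /card_uniqP -> : uniq (take (nfill M) s) by rewrite take_uniq // us enum_uniq.
  by rewrite size_take_min ss -cardE.
have selS p x : select p x \subset masked x.
  by apply/fintype.subsetP => i; rewrite inE => /mem_take; rewrite mem_sort mem_enum.
have cardM k : #|masked (tf_seq theta (val y) k)| = (#|Omega M| - k * nfill M)%N.
  elim: k => [|k IH].
    rewrite mul0n subn0; apply: eq_card => i; rewrite inE ffunE.
    by case: ifPn => [|iO]; [rewrite eqxx|apply/negbTE/promptP].
  have -> : masked (tf_seq theta (val y) k.+1) =
      (masked (tf_seq theta (val y) k) :\: tf_select theta (val y) k)%SET.
    apply/finset.setP => i; rewrite finset.in_setD.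
    rewrite !(finset.in_set (fun i => _ i == _)) {1}/tf_seq /tf_state iterS ffunE.
    rewrite -/(tf_state theta (val y) k) -/(tf_select theta (val y) k).
    case: ifP => // iS.
    have iM := fintype.subsetP (selS _ _) _ iS.
    have iO : i \in Omega M.
      by apply: contraLR iM => iO; rewrite finset.in_set offO // promptP.
    by have /forallP/(_ i) := valP y; rewrite iO => /negbTE.
  rewrite cardsD (finset.setIidPr (selS _ _)) card_sel IH mulSn.
  by rewrite minnE; case: (leqP (nfill M) (#|Omega M| - k * nfill M)) => H; lia.
rewrite cardM /num_steps subn_eq0.
rewrite -[RHS]ltnS ltn_divLR // mulSn; case: (nfill M) u0 => // n _ /=; lia.
Qed.

(* Transition probabilities: the positions of [S] are filled independently
   according to [p], the others are left unchanged. *)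
Definition fill_prob (p : 'I_L -> V -> R) (S : {set 'I_L})
    (x x' : sequence) : R :=
  if [forall i, (i \notin S) ==> (x' i == x i)]
  then \prod_(i in S) p i (x' i) else 0.

(* Probability that the sampler goes from sequence [x] and carry [h] to
   sequence [y] in [n] steps. *)
Fixpoint sample_prob (theta : param) (n : nat) (x : sequence) (h : carry)
    (y : sequence) : R :=
  if n is n'.+1 then
    let p := probs theta x h in
    \sum_(x' : sequence) fill_prob p (select p x) x x' *
      sample_prob theta n' x' (next_carry theta x h) y
  else (x == y)%:R.

Definition psample (theta : param) (y : response) : R :=
  sample_prob theta num_steps init 0 (val y).

Definition cross_entropy (y x : sequence) (T : {set 'I_L}) (theta : param)
    (h : carry) : R :=
  \sum_(i in T) - ln (probs theta x h i (y i)).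

Definition loss_set theta y j : {set 'I_L} :=
  if loss_on_all M j then masked (tf_seq theta y j) else tf_select theta y j.

(* Loss at step [j] as a function of [(theta, h)], the sequence and the set of
   positions being those of the teacher-forced trajectory for [theta0]. *)
Definition step_loss (theta0 : param) (y : sequence) (j : nat)
    (theta : param) (h : carry) : R :=
  weight (tf_seq theta0 y j) *
  cross_entropy y (tf_seq theta0 y j) (loss_set theta0 y j) theta h.

Definition loss_inf (theta : param) : R :=
  \sum_(y : response) pstar y *
    \sum_(j < num_steps)
      step_loss theta (val y) j theta (tf_carry theta (val y) j).

Definition loss_revealed (theta : param) : R :=
  \sum_(y : response) pstar y *
    \sum_(j < num_steps)
      cross_entropy (val y) (tf_seq theta (val y) j) (tf_select theta (val y) j)
        theta (tf_carry theta (val y) j).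

Definition denoiser_assumption : Prop :=
  (forall theta x h i, probs theta x h i (mask M) = 0 /\
     forall v, v != mask M -> 0 < probs theta x h i v) /\
  (* analyticity in the coordinates of [(theta, h)] *)
  forall x,
    let at_x T (F : param -> carry -> T) (z : 'rV[R]_(nparam M + L * width M)) :=
      F (lsubmx z) (vec_mx (rsubmx z)) in
    (forall i v, real_analytic (at_x R (fun theta h => probs theta x h i v))) /\
    (forall k l, real_analytic (at_x R (fun theta h => next_carry theta x h k l))).

(* The [k]-th largest confidence over the masked positions, [k >= 1]. *)
Definition kth_confidence (p : 'I_L -> V -> R) (x : sequence) (k : nat) : R :=
  nth 0 (sort (fun a b => b <= a) [seq confidence p i | i <- enum (masked x)])
    k.-1.

Definition regular (theta : param) : Prop :=
  forall y : response, 0 < pstar y -> forall j, (j < num_steps)%N ->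
    let x := tf_seq theta (val y) j in
    let p := probs theta x (tf_carry theta (val y) j) in
    (nfill M < #|masked x|)%N ->
    kth_confidence p x (nfill M).+1 < kth_confidence p x (nfill M).

(* Partial derivatives along the teacher-forced trajectory of [y]:
   d h_(j+1) / d h_j, d h_(j+1) / d theta, d L^(j) / d h_j, d L^(j) / d theta. *)
Definition dcarry_dh theta y j : carry -> carry :=
  'd (fun h => next_carry theta (tf_seq theta y j) h) (tf_carry theta y j).

Definition dcarry_dtheta theta y j : param -> carry :=
  'd (fun theta' => next_carry theta' (tf_seq theta y j) (tf_carry theta y j))
    theta.

Definition dloss_dh theta y j : carry -> R :=
  'd (fun h => step_loss theta y j theta h : R^o) (tf_carry theta y j).

Definition dloss_dtheta theta y j : param -> R :=
  'd (fun theta' => step_loss theta y j theta' (tf_carry theta y j) : R^o)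
    theta.

(* Differentials are composed, the factor [s = 1] being the outermost. *)
Definition truncated_gradient (W : nat) (theta : param) : param :=
  \row_k \sum_(y : response) pstar y * \sum_(j < num_steps)
    (dloss_dtheta theta (val y) j (delta_mx 0 k) +
     \sum_(1 <= r < (j %% W).+1)
       dloss_dh theta (val y) j
         ((\big[(fun f g : carry -> carry => f \o g)/idfun]_(1 <= s < r)
             dcarry_dh theta (val y) (j - s))
           (dcarry_dtheta theta (val y) (j - r) (delta_mx 0 k)))).

Definition contractive_carry (gamma Ch CL : R) : Prop :=
  gamma < 1 /\
  forall theta (y : response), 0 < pstar y -> forall j, (j < num_steps)%N ->
    [/\ opnorm l2norm l2norm (dcarry_dh theta (val y) j) <= gamma,
        opnorm l2norm l2norm (dcarry_dtheta theta (val y) j) <= Ch &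
        opnorm l2norm Num.norm (dloss_dh theta (val y) j) <= CL].

Definition PL_at (mu : R) (theta : param) : Prop :=
  differentiable (loss_inf : param -> R^o) theta /\
  mu * (loss_inf theta - inf (range loss_inf)) <=
    2^-1 * l2norm (gradient loss_inf theta) ^+ 2.

Definition truncation_bound (gamma Ch CL mu : R) (W : nat) : R :=
  let B := CL * Ch / (1 - gamma) ^+ 2 in
  B ^+ 2 / (2 * mu) * (num_steps%:R / W%:R - 1) ^+ 2.

End Model.

Arguments denoiser_assumption {R} M.
Arguments contractive_carry {R} M gamma Ch CL.
Arguments num_steps {R} M.
Arguments loss_inf {R} M theta.
Arguments loss_revealed {R} M theta.
Arguments regular {R} M theta.
Arguments truncated_gradient {R} M W theta.
Arguments PL_at {R} M mu theta.
Arguments psample {R} M theta y.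
Arguments truncation_bound {R} M gamma Ch CL mu W.

(* Main.v *)
From HB Require Import structures.
Require Import Defs.
From mathcomp Require Import all_boot all_order all_algebra.
From mathcomp Require Import all_classical all_reals all_analysis.
Import Order.TTheory GRing.Theory Num.Theory.
Import numFieldNormedType.Exports.

(* The sampler reaches a response y only along the teacher-forced trajectory of
   y, so p_theta(y) is the product of the probabilities of the revealed tokens
   and KL(p* || p_theta) is the revealed loss plus the negative entropy of p*.
   Hence the KL gap is the gap of L_infty, which the Polyak-Lojasiewicz
   inequality bounds by |grad L_infty|^2 / (2 mu).  At a regular parameter the
   selected sets, and with them the sequences, are locally constant, so the
   chain rule expands the gradient g of L_infty over all pairs (step j, delay r).
   The truncated gradient consists of the terms with r <= j mod W; as it
   vanishes, |g|^2 is the sum of the remaining terms applied to g.  Each is at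
   most C_L C_h gamma^(r-1) |g|, and summing the geometric tails over the J/W - 1
   windows after the first one gives |g| <= B (J/W - 1). *)

Set Implicit Arguments.
Unset Strict Implicit.
Unset Printing Implicit Defensive.

Local Open Scope classical_set_scope.
Local Open Scope ring_scope.

(** * Operator norms on matrix spaces *)

Section Norms.
Context {R : realType}.

Lemma l2norm_ge0 m n (A : 'M[R]_(m, n)) : 0 <= l2norm A.
Proof. exact: sqrtr_ge0. Qed.

Lemma l2norm_sqr m n (A : 'M[R]_(m, n)) :
  l2norm A ^+ 2 = \sum_i \sum_j A i j ^+ 2.
Proof.
by rewrite sqr_sqrtr// sumr_ge0// => i _; rewrite sumr_ge0// => j _; apply: sqr_ge0.
Qed.

Lemma l2norm_ge_entry m n (A : 'M[R]_(m, n)) i j : `|A i j| <= l2norm A.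
Proof.
rewrite -sqrtr_sqr ler_wsqrtr// (bigD1 i)//= (bigD1 j)//= -addrA lerDl addr_ge0//.
  by apply: sumr_ge0 => k _; exact: sqr_ge0.
by apply: sumr_ge0 => k _; apply: sumr_ge0 => l _; exact: sqr_ge0.
Qed.

Lemma l2normZ m n (c : R) (A : 'M[R]_(m, n)) : l2norm (c *: A) = `|c| * l2norm A.
Proof.
rewrite /l2norm -[in RHS]sqrtr_sqr -sqrtrM ?sqr_ge0// mulr_sumr.
congr Num.sqrt; apply: eq_bigr => i _; rewrite mulr_sumr.
by apply: eq_bigr => j _; rewrite mxE exprMn.
Qed.

Lemma norm_le_l2norm m n (A : 'M[R]_(m, n)) : `|A| <= l2norm A.
Proof.
rewrite [leLHS]/Num.norm/= mx_normrE; apply: bigmax_le; first exact: l2norm_ge0.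
by move=> ij _; exact: l2norm_ge_entry.
Qed.

Lemma mx_norm_ge_entry m n (A : 'M[R]_(m, n)) i j : `|A i j| <= `|A|.
Proof.
by rewrite [leRHS]/Num.norm/= mx_normrE; exact: (le_bigmax _ _ (i, j)).
Qed.

Lemma l2norm_le_norm m n (A : 'M[R]_(m, n)) :
  l2norm A <= Num.sqrt (m * n)%:R * `|A|.
Proof.
rewrite -[X in _ * X]ger0_norm// -sqrtr_sqr -sqrtrM// ler_wsqrtr//.
rewrite (@le_trans _ _ (\sum_(i < m) \sum_(j < n) `|A| ^+ 2))//.
  apply: ler_sum => i _; apply: ler_sum => j _.
  by rewrite -real_normK ?num_real// lerXn2r ?nnegrE// mx_norm_ge_entry.
by rewrite !sumr_const !card_ord -mulrnA mulr_natl mulnC.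
Qed.

Lemma mx_linear_continuous m n (W : normedModType R)
  (f : {linear 'M[R]_(m, n) -> W}) : continuous f.
Proof.
have -> : (f : 'M[R]_(m, n) -> W) =
    fun A => \sum_i \sum_j A i j *: f (delta_mx i j).
  apply/funext => A; rewrite {1}(matrix_sum_delta A) linear_sum.
  by apply: eq_bigr => i _; rewrite linear_sum; apply: eq_bigr => j _; rewrite linearZ.
move=> A; apply: (@cvg_big _ _ _ _ _ _ _ (nbhs A)) => [|i _].
  exact: add_continuous.
apply: (@cvg_big _ _ _ _ _ _ _ (nbhs A)) => [|j _]; first exact: add_continuous.
by apply: (@cvgZr_tmp _ _ _ (nbhs A)); exact: coord_continuous.
Qed.

Lemma mx_linear_differentiable m n (W : normedModType R)
  (f : {linear 'M[R]_(m, n) -> W}) (A : 'M[R]_(m, n)) : differentiable f A.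
Proof. by apply: linear_differentiable; exact: mx_linear_continuous. Qed.

Lemma differentiable_mx (V : normedModType R) m n (F : V -> 'M[R]_(m, n)) x :
  (forall k l, differentiable (fun y => F y k l : R^o) x) -> differentiable F x.
Proof.
move=> dF.
have -> : F = \sum_k \sum_l (fun y => (F y k l : R^o) *: delta_mx k l).
  apply/funext => y; rewrite [LHS]matrix_sum_delta fct_sumE.
  by apply: eq_bigr => i _; rewrite fct_sumE.
apply: differentiable_sum => k; apply: differentiable_sum => l.
by apply: differentiableZl; exact: dF.
Qed.

(** [opnorm] is a bare [sup], so its set must first be shown bounded: this follows from continuity
    of [A] and the comparison of [nW] with the ambient norm. The estimate at a nonzero [v] then
    comes from rescaling [v] to norm 1. *)
Lemma opnorm_spec m n (W : normedModType R) (nW : W -> R) (K : R)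
    (A : {linear 'M[R]_(m, n) -> W}) :
  (forall c w, nW (c *: w) = `|c| * nW w) -> (forall w, nW w <= K * `|w|) ->
  (forall w, 0 <= nW w) ->
  0 <= opnorm l2norm nW A /\ forall v, nW (A v) <= opnorm l2norm nW A * l2norm v.
Proof.
move=> nWZ nWK nW0.
have nW00 : nW 0 = 0 by rewrite -(scale0r 0) nWZ normr0 mul0r.
have l20 : l2norm (0 : 'M[R]_(m, n)) = 0.
  by rewrite -(scale0r 0) l2normZ normr0 mul0r.
have [k k0 Ak] := linear_lipschitz (@mx_linear_continuous _ _ _ A).
have ub : has_ubound [set nW (A v) | v in [set v | l2norm v <= 1]].
  exists (`|K| * k) => _ [v /= v1 <-]; apply: le_trans (nWK _) _.
  rewrite (le_trans (ler_norm _))// normrM normr_id ler_wpM2l//.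
  rewrite (le_trans (Ak v))// ger_pMr//.
  exact: le_trans (norm_le_l2norm _) v1.
split.
  by apply: ub_le_sup => //; exists 0; rewrite /= ?l20// linear0.
move=> v; have [v0|v0] := eqVneq (l2norm v) 0.
  suff -> : v = 0 by rewrite linear0 nW00 l20 mulr0.
  apply/matrixP => i j; rewrite mxE; apply/eqP.
  by rewrite -normr_le0 -v0 l2norm_ge_entry.
have v_gt0 : 0 < l2norm v by rewrite lt_neqAle eq_sym v0 l2norm_ge0.
rewrite -ler_pdivrMr// mulrC -[X in X * _]gtr0_norm ?invr_gt0// -nWZ -linearZ.
apply: ub_le_sup => //; exists ((l2norm v)^-1 *: v) => //=.
by rewrite l2normZ gtr0_norm ?invr_gt0// mulVf.
Qed.

Lemma opnorm_mx_spec m n p q (A : {linear 'M[R]_(m, n) -> 'M[R]_(p, q)}) :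
  0 <= opnorm l2norm l2norm A /\
  forall v, l2norm (A v) <= opnorm l2norm l2norm A * l2norm v.
Proof.
apply: (@opnorm_spec _ _ _ _ (Num.sqrt (p * q)%:R)).
- exact: l2normZ.
- exact: l2norm_le_norm.
- exact: l2norm_ge0.
Qed.

Lemma opnorm_form_spec m n (A : {linear 'M[R]_(m, n) -> R^o}) :
  0 <= opnorm l2norm Num.norm (A : _ -> R) /\
  forall v, `|A v : R| <= opnorm l2norm Num.norm (A : _ -> R) * l2norm v.
Proof.
apply: (@opnorm_spec _ _ R^o (fun x : R^o => `|x : R|) 1) => //.
- by move=> c w; rewrite -normrM.
- by move=> w; rewrite mul1r.
Qed.

End Norms.

(** * Differentiability of real-analytic functions *)

Section Differentiability.
Context {R : realType}.

(** A quadratic error is little-o of [v], so [df] is the differential; the case [v = 0] forces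
    [b = f a]. *)
Lemma differentiable_quadratic (V W : normedModType R) (f : V -> W) a
    (df : {linear V -> W}) (b : W) (C rho : R) :
  continuous df -> 0 < rho -> 0 <= C ->
  (forall v, `|v| <= rho -> `|f (a + v) - b - df v| <= C * `|v| ^+ 2) ->
  differentiable f a.
Proof.
move=> dfc rho0 C0 fC.
have fa : f a = b.
  have := fC 0; rewrite normr0 addr0 linear0 subr0 expr0n mulr0 normr_le0 subr_eq0.
  by move=> /(_ (ltW rho0))/eqP.
have fE : f \o shift a = cst (f a) + df +o_ 0 id.
  apply/eqaddoP => e e0.
  near=> v.
  have vrho : `|v| <= rho by near: v; exact: nbhs0_le.
  (* [C + 1] keeps the denominator positive when [C = 0]. *)
  have ve : `|v| <= e / (C + 1).
    by near: v; apply: nbhs0_le; rewrite divr_gt0// ltr_wpDl.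
  rewrite [X in `|X| <= _](_ : _ = f (a + v) - b - df v); last first.
    by rewrite -fa -addrA -opprD (addrC a).
  apply: le_trans (fC v vrho) _; rewrite expr2 mulrA ler_wpM2r//.
  rewrite (@le_trans _ _ ((C + 1) * `|v|))// ?ler_wpM2r ?lerDl//.
  by rewrite mulrC -ler_pdivlMr// ltr_wpDl.
by apply/diff_locallyP; rewrite (diff_unique dfc fE).
Unshelve. all: by end_near.
Qed.

(** * Second-order remainder of a power series *)

Section PowerSeries.
Variables (n : nat) (c : ('I_n -> nat) -> R).

Definition monomial (v : 'rV[R]_n) N (k : {ffun 'I_n -> 'I_N}) : R :=
  \prod_i v 0 i ^+ (k i : nat).

Definition unit_index (i : 'I_n) : 'I_n -> nat := fun j => (j == i).

(** Degree-one part of the series with coefficients [c]: the candidate for its differential at the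
    centre. *)
Definition linear_part (v : 'rV[R]_n) : R^o := \sum_i v 0 i * c (unit_index i).

Lemma linear_part_linear : linear linear_part.
Proof.
move=> a u v; rewrite /linear_part scaler_sumr -big_split/=.
by apply: eq_bigr => i _; rewrite !mxE mulrDl scalerAl.
Qed.

HB.instance Definition _ :=
  GRing.isLinear.Build R 'rV[R]_n R^o _ linear_part linear_part_linear.

(** Shrinking the argument by [t] multiplies a monomial by [t] to the power of its total degree,
    which is at most [t ^+ 2] since [t <= 1]. *)
Lemma norm_monomial_le (v : 'rV[R]_n) (t rho : R) N (k : {ffun 'I_n -> 'I_N}) :
  0 <= t <= 1 -> 0 <= rho -> (forall i, `|v 0 i| <= t * rho) ->
  (1 < \sum_i k i)%N -> `|monomial v k| <= t ^+ 2 * monomial (const_mx rho) k.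
Proof.
move=> /andP[t0 t1] rho0 vt k2; rewrite /monomial normr_prod.
apply: (@le_trans _ _ (t ^+ (\sum_i k i) * \prod_i rho ^+ k i)).
  rewrite (big_morph (fun m => t ^+ m) (exprD t) (expr0 t)) -big_split/=.
  apply: ler_prod => i _; rewrite normr_ge0/= normrX -exprMn.
  by rewrite lerXn2r// nnegrE mulr_ge0.
rewrite (eq_bigr (fun i => (const_mx rho : 'rV_n) 0 i ^+ k i)); last first.
  by move=> i _; rewrite mxE.
rewrite ler_wpM2r//; first by rewrite prodr_ge0// => i _; rewrite mxE exprn_ge0.
exact: ler_wiXn2l.
Qed.

(* The multi-indices of total degree at least 2 gain a factor [t ^+ 2] when the
   argument is shrunk by [t]. *)
Lemma power_series_remainder (v : 'rV[R]_n) (t rho : R) N :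
  0 <= t <= 1 -> 0 <= rho -> (forall i, `|v 0 i| <= t * rho) ->
  `|\sum_(k : {ffun 'I_n -> 'I_N.+2}) c (fun i => k i) * monomial v k
    - c (fun=> 0%N) - linear_part v| <=
  t ^+ 2 * \sum_(k : {ffun 'I_n -> 'I_N.+2})
             `|c (fun i => k i) * monomial (const_mx rho) k|.
Proof.
move=> t01 rho0 vt.
(* [k0] and the [h i] are the multi-indices of degree 0 and 1; the side [N.+2] lets the box contain
   the exponent 1. *)
pose k0 : {ffun 'I_n -> 'I_N.+2} := [ffun=> ord0].
pose h (i : 'I_n) : {ffun 'I_n -> 'I_N.+2} := [ffun j => inord (j == i)].
have hE i j : h i j = unit_index i j :> nat.
  by rewrite ffunE inordK//; case: (j == i).
have hk0 i : h i != k0.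
  apply/eqP => /ffunP/(_ i)/(congr1 (@nat_of_ord _)).
  by rewrite hE /unit_index eqxx ffunE.
rewrite (bigD1 k0)//= (bigID (fun k => k \in codom h))/=.
have -> : c (fun i => k0 i) * monomial v k0 = c (fun=> 0%N).
  rewrite /monomial big1 ?mulr1; last by move=> i _; rewrite ffunE expr0.
  by congr c; apply/funext => i; rewrite ffunE.
have -> : \sum_(k | (k != k0) && (k \in codom h)) c (fun i => k i) * monomial v k
    = linear_part v.
  rewrite (reindex_omap h (fun k => [pick i | k i == 1 :> nat])); last first.
    move=> k /andP[_ /codomP[i ->]]; case: pickP => [j|/(_ i)].
      by rewrite hE /unit_index; case: (j =P i) => // ->.
    by rewrite hE /unit_index eqxx.
  apply: eq_big => i.
    rewrite hk0 codom_f/=; apply/eqP; case: pickP => [j|/(_ i)].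
      by rewrite hE /unit_index; case: (j =P i) => // ->.
    by rewrite hE /unit_index eqxx.
  move=> _; rewrite mulrC; congr (_ * c _); last by apply/funext => j; rewrite hE.
  rewrite /monomial (bigD1 i)//= hE /unit_index eqxx expr1 big1 ?mulr1// => j ji.
  by rewrite hE /unit_index (negbTE ji) expr0.
rewrite (addrC (c _)) addrK addrAC subrr add0r.
rewrite (le_trans (ler_norm_sum _ _ _))// mulr_sumr big_mkcond/=.
apply: ler_sum => k _; case: ifPn => [/andP[kk0 kh]|_]; last first.
  by rewrite mulr_ge0// sqr_ge0.
rewrite !normrM mulrCA ler_wpM2l//.
rewrite [X in _ * X]ger0_norm; last by rewrite prodr_ge0// => i _; rewrite mxE exprn_ge0.
apply: norm_monomial_le => //.
(* An index of total degree at most 1 would be some [h i] or [k0], and these have been split off. *)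
rewrite ltnNge; apply/negP; rewrite leq_eqVlt ltnS leqn0 => /orP[|].
  move=> /sum_nat_eq1[i [_ ki kj]]; move/negP: kh; apply; apply/codomP; exists i.
  apply/ffunP => j; apply/val_inj; rewrite /= hE /unit_index.
  by case: (j =P i) => [->//|/eqP ji]; rewrite kj.
rewrite sum_nat_eq0 => /forallP k_eq0; move/negP: kk0; apply; apply/eqP/ffunP => i.
by apply/val_inj; rewrite /= ffunE; exact/eqP/k_eq0.
Qed.

End PowerSeries.

(** Absolute convergence at the point with all coordinates [rho = r / 2] bounds the sums of absolute
    values by [C]. Scaling by [t = |v| / rho] bounds the remainder of each partial sum by
    [C * t ^+ 2], a quadratic estimate that survives the limit. *)
Lemma real_analytic_differentiable n (f : 'rV[R]_n -> R) a :
  real_analytic f -> differentiable (f : 'rV[R]_n -> R^o) a.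
Proof.
move=> /(_ a)[c [r [r0 fE]]].
pose rho := r / 2; have rho0 : 0 < rho by rewrite divr_gt0.
have rho_r (i : 'I_n) : `|(const_mx rho : 'rV[R]_n) 0 i| < r.
  by rewrite mxE gtr0_norm// /rho ltr_pdivrMr// ltr_pMr// ltr1n.
have [/cvg_seq_bounded[C0 [_ C0P]] _] := fE _ rho_r.
(* Boundedness is available for constants strictly above [C0]. *)
pose C := `|C0| + 1.
have C_ge0 : 0 <= C by rewrite addr_ge0.
have CP N : \sum_(k : {ffun 'I_n -> 'I_N})
    `|c (fun i => k i) * monomial (const_mx rho) k| <= C.
  apply: le_trans (ler_norm _) _; apply: (C0P C) => //.
  by rewrite (le_lt_trans (ler_norm _))// ltrDl.
apply: (@differentiable_quadratic _ R^o f a (linear_part c) (c (fun=> 0%N))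
  (C / rho ^+ 2) rho) => //; [exact: mx_linear_continuous|
  by rewrite divr_ge0// sqr_ge0|].
move=> v vrho; pose t := `|v| / rho.
have t01 : 0 <= t <= 1.
  by rewrite divr_ge0 ?(ltW rho0)//= ler_pdivrMr// mul1r.
have vt i : `|v 0 i| <= t * rho by rewrite /t divfK ?gt_eqF// mx_norm_ge_entry.
have v_r (i : 'I_n) : `|v 0 i| < r.
  rewrite (le_lt_trans (mx_norm_ge_entry _ _ _))//.
  by rewrite (le_lt_trans vrho)// /rho ltr_pdivrMr// ltr_pMr// ltr1n.
have [_ fv] := fE _ v_r.
pose u N := `|\sum_(k : {ffun 'I_n -> 'I_N}) c (fun i => k i) * monomial v k
    - c (fun=> 0%N) - linear_part c v|.
have ucvg : u @ \oo --> `|f (a + v) - c (fun=> 0%N) - linear_part c v : R|.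
  by apply: cvg_norm; apply: cvgB; [apply: cvgB => //|]; exact: cvg_cst.
rewrite -(cvg_lim _ ucvg)//; apply: limr_le; first by apply/cvg_ex; eexists; exact: ucvg.
near=> N.
(* From side 2 on, the box contains every multi-index of degree at most 1. *)
have [K ->] : exists K, N = K.+2.
  exists (N - 2)%N; rewrite -addn2 subnK//.
  by near: N; exact: nbhs_infty_ge.
apply: le_trans (@power_series_remainder _ _ _ t rho _ t01 (ltW rho0) vt) _.
rewrite mulrC (mulrAC C) -mulrA -expr_div_n -/t.
by rewrite ler_wpM2r ?sqr_ge0.
Unshelve. all: by end_near.
Qed.

End Differentiability.

(** * Chain rule in the parameter and the carry *)

Section PartialDerivatives.
Context {R : realType} {p m n : nat} {W : normedModType R}.
Implicit Types (F : 'rV[R]_p -> 'M[R]_(m, n) -> W).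

Definition jointly_differentiable F : Prop := forall z : 'rV[R]_(p + m * n),
  differentiable (fun z => F (lsubmx z) (vec_mx (rsubmx z))) z.

(** [pair_l] and [pair_r] embed parameter and carry as the two blocks of one row vector, so that a
    function of both becomes a function of [pair_l theta + pair_r h]. *)
Definition pair_l (theta : 'rV[R]_p) : 'rV[R]_(p + m * n) := row_mx theta 0.
Definition pair_r (h : 'M[R]_(m, n)) : 'rV[R]_(p + m * n) := row_mx 0 (mxvec h).

Lemma pair_l_linear : linear pair_l.
Proof. by move=> a u v; rewrite /pair_l scale_row_mx add_row_mx scaler0 addr0. Qed.

Lemma pair_r_linear : linear pair_r.
Proof.
by move=> a u v; rewrite /pair_r scale_row_mx add_row_mx scaler0 addr0 linearP.
Qed.

HB.instance Definition _ := GRing.isLinear.Build R _ _ _ pair_l pair_l_linear.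
HB.instance Definition _ := GRing.isLinear.Build R _ _ _ pair_r pair_r_linear.

(** The total map and both partial maps factor through the same one-variable function [G]. Their
    differentials are ['d G] at the common point [z0] composed with the embeddings, and additivity
    of ['d G z0] gives the formula. *)
Lemma jointly_differentiable_diff F (h : 'rV[R]_p -> 'M[R]_(m, n)) theta :
  jointly_differentiable F -> differentiable h theta ->
  differentiable (fun t => F t (h t)) theta /\
  forall v, 'd (fun t => F t (h t)) theta v =
    'd (fun t => F t (h theta)) theta v + 'd (F theta) (h theta) ('d h theta v).
Proof.
move=> dF dh.
pose G z := F (lsubmx z) (vec_mx (rsubmx z)).
have GE t k : F t k = G (pair_l t + pair_r k).
  by rewrite /G /pair_l /pair_r add_row_mx addr0 add0r row_mxKl row_mxKr mxvecK.
have dl t : is_diff t pair_l pair_l.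
  apply: DiffDef; first exact: mx_linear_differentiable.
  exact/diff_lin/mx_linear_continuous.
have dr k : is_diff k pair_r pair_r.
  apply: DiffDef; first exact: mx_linear_differentiable.
  exact/diff_lin/mx_linear_continuous.
pose z0 := pair_l theta + pair_r (h theta).
have dG z : is_diff z G ('d G z) by apply: DiffDef => //; exact: dF.
have dh' : is_diff theta h ('d h theta) by exact: DiffDef.
have d1 : is_diff theta (G \o (pair_l + (pair_r \o h)))
    ('d G z0 \o (pair_l + (pair_r \o 'd h theta))).
  exact: (is_diff_comp (is_diffD (dl theta) (is_diff_comp dh' (dr (h theta)))) (dG z0)).
have d2 : is_diff theta (G \o (pair_l + cst (pair_r (h theta))))
    ('d G z0 \o (pair_l + 0)).
  exact: (is_diff_comp (is_diffD (dl theta) (is_diff_cst _ _)) (dG z0)).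
have d3 : is_diff (h theta) (G \o (cst (pair_l theta) + pair_r))
    ('d G z0 \o (0 + pair_r)).
  exact: (is_diff_comp (is_diffD (is_diff_cst _ _) (dr (h theta))) (dG z0)).
have -> : (fun t => F t (h t)) = G \o (pair_l + (pair_r \o h)).
  by apply/funext => t; rewrite GE.
have -> : (fun t => F t (h theta)) = G \o (pair_l + cst (pair_r (h theta))).
  by apply/funext => t; rewrite GE.
have -> : F theta = G \o (cst (pair_l theta) + pair_r).
  by apply/funext => t; rewrite GE.
split; first exact: ex_diff.
move=> v.
have e1 := @diff_val _ _ _ _ _ _ _ d1.
have e2 := @diff_val _ _ _ _ _ _ _ d2.
have e3 := @diff_val _ _ _ _ _ _ _ d3.
transitivity ('d G z0 (pair_l v + pair_r ('d h theta v))).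
  exact: (congr1 (fun f : 'rV[R]_p -> W => f v) e1).
rewrite linearD; apply: esym; congr (_ + _).
  apply: (etrans (congr1 (fun f : 'rV[R]_p -> W => f v) e2)).
  by congr ('d G z0 _); rewrite -[RHS]addr0.
apply: (etrans (congr1 (fun f : 'M[R]_(m, n) -> W => f _) e3)).
by congr ('d G z0 _); rewrite -[RHS]add0r.
Qed.

End PartialDerivatives.

Lemma diff_sum_form {R : realType} {V : normedModType R} (I : Type) (r : seq I)
    (f : I -> V -> R^o) (c : I -> R) a :
  (forall i, c i != 0 -> differentiable (f i) a) ->
  differentiable (fun x => \sum_(i <- r) c i * f i x : R^o) a /\
  forall v, 'd (fun x => \sum_(i <- r) c i * f i x : R^o) a v =
            \sum_(i <- r) c i * 'd (f i) a v.
Proof.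
move=> df; elim: r => [|i r [dr IH]].
  under eq_fun do rewrite big_nil.
  split; first exact: differentiable_cst.
  by move=> v; rewrite big_nil (@diff_cst _ _ R^o).
under eq_fun do rewrite big_cons.
have [ci|ci] := eqVneq (c i) 0.
  under eq_fun do rewrite ci mul0r add0r.
  by split=> // v; rewrite big_cons ci mul0r add0r.
have dfi := df _ ci.
rewrite [X in differentiable X _](_ : _ =
  (c i *: f i : V -> R^o) + (fun x => \sum_(i <- r) c i * f i x)); last by [].
split; first exact/differentiableD/dr/differentiableZ.
move=> v; rewrite big_cons -IH.
have dD := diffD (differentiableZ (c i) dfi) dr.
apply: (etrans (congr1 (fun g : V -> R^o => g v) dD)); congr (_ + _).
exact: (congr1 (fun g : V -> R^o => g v) (diffZ (c i) dfi)).
Qed.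

Lemma differentiable_ln {R : realType} (x : R) : 0 < x ->
  differentiable (@ln R : R -> R^o) x.
Proof. by move=> x0; apply/derivable1_diffP; have [] := is_derive1_ln x0. Qed.

(** * Differentiating along the teacher-forced trajectory *)

(** Peels off the outermost factor and lowers the base index instead, so that an induction on the
    delay can move one step back along the trajectory. *)
Lemma big_comp_subn (T : Type) (F : nat -> T -> T) j r :
  \big[(fun f g : T -> T => f \o g)/idfun]_(1 <= s < r.+2) F (j - s)%N =
  F j.-1 \o
    \big[(fun f g : T -> T => f \o g)/idfun]_(1 <= s < r.+1) F (j.-1 - s)%N.
Proof.
rewrite big_ltn// subn1 big_add1; congr (_ \o _).
by apply: eq_bigr => s _; rewrite -subn1 -subnDA add1n.
Qed.

Section TeacherForcedTrajectory.
Context {R : realType} (M : model R).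
Local Notation V := (vocab M).
Local Notation L := (len M).
Local Notation sequence := {ffun 'I_L -> V}.
Local Notation param := 'rV[R]_(nparam M).
Local Notation carry := 'M[R]_(L, width M).
Hypothesis denoiser : denoiser_assumption M.
Implicit Types (theta : param) (x y : sequence) (h : carry).

Lemma probs_gt0 theta x h i v : v != Defs.mask M -> 0 < probs theta x h i v.
Proof. by case: denoiser => H _; case: (H theta x h i) => _; apply. Qed.

Lemma response_neq_mask (y : response M) i : val y i != Defs.mask M.
Proof.
have /forallP/(_ i) := valP y; case: ifP => // iO /eqP ->.
by apply: promptP; rewrite iO.
Qed.

Lemma probs_jointly_differentiable x i v :
  jointly_differentiable (fun theta h => probs theta x h i v : R^o).
Proof.
case: denoiser => _ /(_ x)[/(_ i v) an _] z.
exact: real_analytic_differentiable.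
Qed.

Lemma next_carry_jointly_differentiable x :
  jointly_differentiable (fun theta h => next_carry theta x h).
Proof.
case: denoiser => _ /(_ x)[_ an] z; apply: differentiable_mx => k l.
exact: real_analytic_differentiable.
Qed.

Lemma step_loss_jointly_differentiable theta0 (y : response M) j :
  jointly_differentiable (fun theta h => step_loss theta0 (val y) j theta h : R^o).
Proof.
move=> z; rewrite /step_loss /cross_entropy.
have dlog i : differentiable (fun z => ln (probs (lsubmx z)
    (tf_seq theta0 (val y) j) (vec_mx (rsubmx z)) i (val y i)) : R^o) z.
  apply: (@differentiable_comp _ _ _ _ _ (@ln R : R -> R^o)).
    exact: probs_jointly_differentiable.
  (* A response contains no mask, so the argument of the logarithm is positive. *)
  exact/differentiable_ln/probs_gt0/response_neq_mask.
under eq_fun do rewrite mulr_sumr big_mkcond/=.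
have [+ _] := @diff_sum_form _ _ _ (index_enum 'I_L) (fun i z => ln (probs (lsubmx z)
    (tf_seq theta0 (val y) j) (vec_mx (rsubmx z)) i (val y i)) : R^o)
  (fun i => if i \in loss_set theta0 (val y) j
            then - weight (tf_seq theta0 (val y) j) else 0) z (fun i _ => dlog i).
congr (differentiable _ z); apply/funext => t; apply: eq_bigr => i _.
by case: ifP => _; rewrite ?mul0r// mulrN mulNr.
Qed.

(* Carry and loss along the trajectory of [y] when the sequences and the selected
   sets are kept as they are at [theta0]; unlike [tf_carry] they are
   differentiable in [theta] everywhere. *)
Fixpoint frozen_carry theta0 y j theta : carry :=
  if j is i.+1 then next_carry theta (tf_seq theta0 y i) (frozen_carry theta0 y i theta)
  else 0.

Lemma frozen_carryE theta0 y j : frozen_carry theta0 y j theta0 = tf_carry theta0 y j.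
Proof. by elim: j => [//|j /= ->]. Qed.

(** Surrogate for [loss_inf] to which the chain rule applies directly; the two coincide near a
    regular [theta0]. *)
Definition frozen_loss theta0 theta : R :=
  \sum_(y : response M) pstar y *
    \sum_(j < num_steps M)
      step_loss theta0 (val y) j theta (frozen_carry theta0 (val y) j theta).

Lemma frozen_carry_diff theta0 y j :
  differentiable (frozen_carry theta0 y j) theta0 /\
  forall v, 'd (frozen_carry theta0 y j.+1) theta0 v =
    dcarry_dtheta theta0 y j v + dcarry_dh theta0 y j ('d (frozen_carry theta0 y j) theta0 v).
Proof.
have chain i c t := @jointly_differentiable_diff _ _ _ _ _ _ c t
  (next_carry_jointly_differentiable (tf_seq theta0 y i)).
suff dj : differentiable (frozen_carry theta0 y j) theta0.
  split=> // v; have [_ /(_ v)] := chain j _ _ dj.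
  by rewrite frozen_carryE.
elim: j => [|j IH]; first exact: differentiable_cst.
exact: (chain j _ _ IH).1.
Qed.

(** This is d h_j / d h_(j-r+1), a product of [r - 1] one-step Jacobians; [backprop] precomposes it
    with the direct dependence of h_(j-r+1) on the parameter. *)
Definition carry_jacobian theta y j r : carry -> carry :=
  \big[(fun f g : carry -> carry => f \o g)/idfun]_(1 <= s < r)
    dcarry_dh theta y (j - s).

Definition backprop theta y j r (v : param) : carry :=
  carry_jacobian theta y j r (dcarry_dtheta theta y (j - r) v).

Lemma carry_jacobian1 theta y j : carry_jacobian theta y j 1 = idfun.
Proof. by rewrite /carry_jacobian big_geq. Qed.

Lemma carry_jacobianSS theta y j r :
  carry_jacobian theta y j r.+2 =
    dcarry_dh theta y j.-1 \o carry_jacobian theta y j.-1 r.+1.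
Proof.
exact: (big_comp_subn (dcarry_dh theta y)).
Qed.

Lemma carry_jacobian_linear theta y j r : linear (carry_jacobian theta y j r).
Proof.
case: r => [|r]; first by rewrite /carry_jacobian big_geq.
elim: r j => [|r IH] j; first by rewrite carry_jacobian1.
by move=> a u v; rewrite carry_jacobianSS /= IH /dcarry_dh linearP.
Qed.

Lemma backprop_linear theta y j r : linear (backprop theta y j r).
Proof. by move=> a u v; rewrite /backprop /dcarry_dtheta linearP carry_jacobian_linear. Qed.

(** Unrolls the one-step chain rule: step [j] adds the term of delay 1, and its Jacobian raises
    every earlier delay by one. *)
Lemma diff_frozen_carry theta y j v :
  'd (frozen_carry theta y j) theta v = \sum_(1 <= r < j.+1) backprop theta y j r v.
Proof.
elim: j => [|j IH].
  by rewrite big_geq//; exact: (congr1 (fun f : param -> carry => f v) (diff_cst _ _)).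
rewrite [RHS]big_ltn// [LHS](frozen_carry_diff theta y j).2; congr (_ + _).
  by rewrite /backprop carry_jacobian1 subn1.
rewrite [RHS]big_add1 IH {1}/dcarry_dh linear_sum.
apply: eq_big_nat => -[//|r] _.
by rewrite /backprop carry_jacobianSS.
Qed.

(** This has the shape of [truncated_gradient], except that the delays run up to [j], back to the
    first step, instead of stopping at the start of the window. *)
Lemma diff_frozen_loss theta v :
  differentiable (frozen_loss theta : param -> R^o) theta /\
  'd (frozen_loss theta : param -> R^o) theta v =
    \sum_(y : response M) pstar y * \sum_(j < num_steps M)
      (dloss_dtheta theta (val y) j v +
       \sum_(1 <= r < j.+1) dloss_dh theta (val y) j (backprop theta (val y) j r v)).
Proof.
have chain (y : response M) j := jointly_differentiable_diff
  (@step_loss_jointly_differentiable theta y j) (frozen_carry_diff theta (val y) j).1.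
have dsum (y : response M) := @diff_sum_form _ _ _ (index_enum 'I_(num_steps M))
  (fun j t => step_loss theta (val y) j t (frozen_carry theta (val y) j t) : R^o)
  (fun=> 1) theta (fun j _ => (chain y j).1).
have [df dE] := @diff_sum_form _ _ _ (index_enum (response M)) _
  (@pstar _ M) theta (fun (y : response M) _ => (dsum y).1).
have flE : frozen_loss theta = (fun t => \sum_(y : response M) pstar y *
    \sum_(j < num_steps M) 1 * step_loss theta (val y) j t (frozen_carry theta (val y) j t)).
  by apply/funext => t; under [RHS]eq_bigr do under eq_bigr do rewrite mul1r.
rewrite flE; split=> //.
rewrite dE; apply: eq_bigr => y _; rewrite (dsum y).2; congr (_ * _).
apply: eq_bigr => j _; rewrite mul1r (chain y j).2 frozen_carryE; congr (_ + _).
by rewrite diff_frozen_carry linear_sum.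
Qed.

End TeacherForcedTrajectory.

(** * Stability of the selected set *)

Section Selection.
Context {R : realType} (M : model R).
Local Notation V := (vocab M).
Local Notation L := (len M).
Local Notation sequence := {ffun 'I_L -> V}.
Implicit Types (p : 'I_L -> V -> R) (x : sequence).

Lemma precedes_confidence p i k : precedes p i k -> confidence p k <= confidence p i.
Proof. by move=> /orP[/ltW//|/andP[/eqP->]]. Qed.

Lemma precedes_total p : total (precedes p).
Proof.
move=> i k; rewrite /precedes; case: (ltgtP (confidence p i) (confidence p k)) => //=.
by move=> _; exact: leq_total.
Qed.

Lemma precedes_trans p : transitive (precedes p).
Proof.
move=> k i l /orP[ki|/andP[/eqP ki ik]] /orP[lk|/andP[/eqP lk kl]].
- by rewrite /precedes (lt_trans lk ki).
- by rewrite /precedes lk ki.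
- by rewrite /precedes -ki lk.
- by rewrite /precedes lk ki eqxx (leq_trans ik kl) orbT.
Qed.

Lemma card_select p x : #|select p x| = minn (nfill M) #|masked x|.
Proof.
rewrite /select cardsE; set s := sort _ _.
have /card_uniqP -> : uniq (take (nfill M) s).
  by rewrite take_uniq// sort_uniq enum_uniq.
by rewrite size_take_min size_sort -cardE.
Qed.

Lemma mem_select p x i :
  (i \in select p x) = (i \in take (nfill M) (sort (precedes p) (enum (masked x)))).
Proof. by rewrite inE. Qed.

Lemma select_masked p x : select p x \subset masked x.
Proof.
by apply/fintype.subsetP => i; rewrite inE => /mem_take; rewrite mem_sort mem_enum.
Qed.

Lemma select_precedes p x i k : i \in select p x -> k \in masked x ->
  k \notin select p x -> precedes p i k.
Proof.
rewrite !mem_select; set s := sort _ _ => iS.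
rewrite -mem_enum -(mem_sort (precedes p)) -/s.
rewrite -{1}(cat_take_drop (nfill M) s) mem_cat => /orP[->//|kD _].
have : sorted (precedes p) s by apply: sort_sorted; exact: precedes_total.
rewrite (sorted_pairwise (@precedes_trans p)) -(cat_take_drop (nfill M) s).
by rewrite pairwise_cat => /andP[/allrelP + _]; apply.
Qed.

(** Sorting the confidences and sorting the positions give the same list of values, because a sorted
    list is determined by its multiset. Ties between positions therefore do not matter. *)
Lemma kth_confidenceE p x k :
  kth_confidence p x k =
  nth 0 (map (confidence p) (sort (precedes p) (enum (masked x)))) k.-1.
Proof.
rewrite /kth_confidence; congr nth; apply: (@sorted_eq _ (fun a b => b <= a)).
- by move=> a b c ba cb; exact: le_trans cb ba.
- by move=> a b; rewrite andbC => /le_anti.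
- by apply: sort_sorted => a b; rewrite le_total.
- rewrite sorted_map; apply: sub_sorted (sort_sorted (@precedes_total p) _).
  by move=> i l /= /precedes_confidence.
- by rewrite perm_sort perm_map// perm_sym perm_sort.
Qed.

(** In the sorted list a selected position has index at most [(nfill M).-1] and an unselected one at
    least [nfill M], so the gap of regularity lies between their confidences. *)
Lemma select_gap p x i k :
  kth_confidence p x (nfill M).+1 < kth_confidence p x (nfill M) ->
  (nfill M < #|masked x|)%N ->
  i \in select p x -> k \in masked x -> k \notin select p x ->
  confidence p k < confidence p i.
Proof.
rewrite !kth_confidenceE !mem_select => gap uM iS.
rewrite -mem_enum -(mem_sort (precedes p)).
set s := sort _ _ in iS gap *; move=> ks kS.
have ss : size s = #|masked x| by rewrite size_sort -cardE.
have u0 := nfill_gt0 M.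
have sorted_s : sorted (precedes p) s by apply: sort_sorted; exact: precedes_total.
have mono a b : (a <= b < size s)%N ->
    nth 0 (map (confidence p) s) b <= nth 0 (map (confidence p) s) a.
  move=> /andP[ab bs]; have as_ := leq_ltn_trans ab bs.
  rewrite !(nth_map i)//; apply: precedes_confidence.
  apply: (sorted_leq_nth (@precedes_trans p)) => //.
  by move=> l; have /orP[] := precedes_total p l l.
have confE l : l \in s -> confidence p l = nth 0 (map (confidence p) s) (index l s).
  by move=> ls; rewrite (nth_map i) ?index_mem// nth_index.
have is_ : i \in s by exact: mem_take iS.
rewrite !confE//; apply: le_lt_trans (lt_le_trans gap _); apply: mono.
  rewrite /= index_mem ks andbT leqNgt; apply: contra kS => ku.
  by rewrite in_take.
rewrite ss (leq_ltn_trans (leq_pred _) uM) andbT.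
by rewrite -ltnS prednK// -in_take.
Qed.

(** Both selections have the same size. If they differed, some [k] would replace some [i]; then [k]
    precedes [i] under [q], although [i] has the strictly larger confidence. *)
Lemma select_eq p q x :
  (forall i k, i \in select p x -> k \in masked x -> k \notin select p x ->
     confidence q k < confidence q i) ->
  select q x = select p x.
Proof.
move=> gap; apply/eqP; rewrite eqEcard !card_select leqnn andbT.
apply/fintype.subsetP => k kq; apply/negPn/negP => kp.
have /fintype.subsetPn[i ip iq] : ~~ (select p x \subset select q x).
  apply: contra kp => pq; have /eqP -> // : select p x == select q x.
  by rewrite eqEcard pq !card_select leqnn.
have kM := fintype.subsetP (select_masked q x) _ kq.
have iM := fintype.subsetP (select_masked p x) _ ip.
have /precedes_confidence := select_precedes kq iM iq.
by rewrite leNgt gap.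
Qed.

Lemma select_all p q x : (#|masked x| <= nfill M)%N -> select q x = select p x.
Proof.
move=> Mu; apply: select_eq => i k _ kM.
suff -> : select p x = masked x by rewrite kM.
by apply/eqP; rewrite eqEcard select_masked card_select (minn_idPr Mu) leqnn.
Qed.

Lemma confidence_cvg (T : Type) (F : set_system T) (FF : Filter F)
    (q : T -> 'I_L -> V -> R) p i :
  (forall v, q t i v @[t --> F] --> p i v) ->
  confidence (q t) i @[t --> F] --> confidence p i.
Proof.
move=> qp; apply: (@cvg_big _ _ _ _ _ _ _ F) => [|v _]; last exact: qp.
exact: max_continuous.
Qed.

(** Either all masked positions are selected whatever the confidences, or the gap makes finitely
    many strict inequalities between limits, all of which persist nearby. *)
Lemma select_near (T : Type) (F : set_system T) (FF : Filter F)
    (q : T -> 'I_L -> V -> R) p x :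
  (forall i v, q t i v @[t --> F] --> p i v) ->
  ((nfill M < #|masked x|)%N ->
     kth_confidence p x (nfill M).+1 < kth_confidence p x (nfill M)) ->
  \forall t \near F, select (q t) x = select p x.
Proof.
move=> qp; case: (leqP #|masked x| (nfill M)) => [Mu _|Mu /(_ isT) gap].
  by near=> t; exact: select_all.
have lt_near i k : confidence p k < confidence p i ->
    \forall t \near F, confidence (q t) k < confidence (q t) i.
  move=> ki; near=> t; rewrite -subr_gt0; near: t.
  have cB : (confidence (q t) i - confidence (q t) k) @[t --> F] -->
            confidence p i - confidence p k.
    by apply: cvgB; apply: confidence_cvg => v; exact: qp.
  by apply: (cvgr_gt _ cB); rewrite subr_gt0.
have : \forall t \near F, forall ik : 'I_L * 'I_L,
    confidence p ik.2 < confidence p ik.1 ->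
    confidence (q t) ik.2 < confidence (q t) ik.1.
  apply: filter_forall => -[i k] /=.
  by case: (ltP (confidence p k) (confidence p i)) => [/lt_near|_];
    [apply: filterS|near=> t].
apply: filterS => t tP; apply: select_eq => i k ip kM kp.
by apply: (tP (i, k)); exact: select_gap gap Mu ip kM kp.
Unshelve. all: by end_near.
Qed.

End Selection.

(** * Local constancy of the trajectories at a regular parameter *)

Section LocalConstancy.
Context {R : realType} (M : model R).
Local Notation param := 'rV[R]_(nparam M).
Hypothesis denoiser : denoiser_assumption M.
Variable theta0 : param.
Hypothesis reg : regular M theta0.

Lemma tf_select_near (y : response M) j : 0 < pstar y -> (j < num_steps M)%N ->
  \forall theta \near theta0,
    select (probs theta (tf_seq theta0 (val y) j) (frozen_carry theta0 (val y) j theta))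
      (tf_seq theta0 (val y) j) = tf_select theta0 (val y) j.
Proof.
move=> py jJ; apply: (@select_near _ _ _ (nbhs theta0)); last exact: reg py _ jJ.
move=> i v.
have [+ _] := jointly_differentiable_diff
  (@probs_jointly_differentiable _ _ denoiser (tf_seq theta0 (val y) j) i v)
  (frozen_carry_diff denoiser theta0 (val y) j).1.
move=> /differentiable_continuous pc.
by rewrite -(frozen_carryE theta0 (val y) j); exact: pc.
Qed.

Lemma tf_state_near (y : response M) j : 0 < pstar y -> (j <= num_steps M)%N ->
  \forall theta \near theta0,
    tf_state theta (val y) j =
      (tf_seq theta0 (val y) j, frozen_carry theta0 (val y) j theta).
Proof.
move=> py; elim: j => [|j IH] jJ; first by near=> theta.
near=> theta.
have stE : tf_state theta (val y) j =
    (tf_seq theta0 (val y) j, frozen_carry theta0 (val y) j theta).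
  by near: theta; exact: IH (ltnW jJ).
have selE : select (probs theta (tf_seq theta0 (val y) j)
    (frozen_carry theta0 (val y) j theta)) (tf_seq theta0 (val y) j) =
    tf_select theta0 (val y) j.
  by near: theta; exact: tf_select_near.
by rewrite /tf_state iterS -/(tf_state _ _ j) stE /tf_step /= selE.
Unshelve. all: by end_near.
Qed.

Lemma loss_inf_near : \forall theta \near theta0,
  loss_inf M theta = frozen_loss theta0 theta.
Proof.
have H : \forall theta \near theta0, forall (yj : response M * 'I_(num_steps M)),
    0 < pstar yj.1 ->
    tf_state theta (val yj.1) yj.2 =
      (tf_seq theta0 (val yj.1) yj.2, frozen_carry theta0 (val yj.1) yj.2 theta) /\
    tf_select theta (val yj.1) yj.2 = tf_select theta0 (val yj.1) yj.2.
  apply: (@filter_forall _ _ _ (nbhs theta0)) => -[y j] /=.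
  have [py|_] := ltP 0 (pstar y); last by near=> theta.
  near=> theta => _.
  have stE : tf_state theta (val y) j =
      (tf_seq theta0 (val y) j, frozen_carry theta0 (val y) j theta).
    by near: theta; apply: tf_state_near => //; exact: ltnW.
  split=> //; rewrite /tf_select /tf_seq /tf_carry stE /=.
  by near: theta; exact: tf_select_near.
apply: filterS H => theta H.
apply: eq_bigr => y _; have [p0 _] := pstar_distr M.
(* Regularity only concerns the support of [pstar]; the other responses have coefficient 0. *)
have := p0 y; rewrite le_eqVlt => /orP[/eqP <-|py]; first by rewrite !mul0r.
congr (_ * _); apply: eq_bigr => j _; have [stE selE] := H (y, j) py.
rewrite /step_loss /loss_set /tf_carry selE.
have -> : tf_seq theta (val y) j = tf_seq theta0 (val y) j.
  by rewrite {1}/tf_seq stE.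
by rewrite stE.
Unshelve. all: by end_near.
Qed.

Lemma diff_loss_inf v : differentiable (loss_inf M : param -> R^o) theta0 ->
  'd (loss_inf M : param -> R^o) theta0 v =
  'd (frozen_loss theta0 : param -> R^o) theta0 v.
Proof.
move=> dL; have dF := (diff_frozen_loss denoiser theta0 v).1.
apply: etrans (esym (deriveE v dL)) _; apply: etrans (deriveE v dF).
by apply: near_eq_derive; exact: loss_inf_near.
Qed.

End LocalConstancy.

(** * Law of the sampler *)

Section Sampler.
Context {R : realType} (M : model R).
Local Notation V := (vocab M).
Local Notation L := (len M).
Local Notation sequence := {ffun 'I_L -> V}.
Local Notation param := 'rV[R]_(nparam M).
Local Notation carry := 'M[R]_(L, width M).
Hypothesis denoiser : denoiser_assumption M.
Implicit Types (theta : param) (x : sequence) (y : response M) (h : carry).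

Lemma probs_mask theta x h i : probs theta x h i (Defs.mask M) = 0.
Proof. by case: denoiser => H _; case: (H theta x h i). Qed.

Lemma probs_le1 theta x h i v : probs theta x h i v <= 1.
Proof.
have [p0 <-] := fcarry_distr theta x h i.
by rewrite (bigD1 v)//= lerDl sumr_ge0.
Qed.

(** Only masked positions are ever selected, so a revealed token survives to the end. *)
Lemma sample_prob_unmasked theta n x h (y : sequence) i :
  sample_prob theta n x h y != 0 -> x i != Defs.mask M -> y i = x i.
Proof.
elim: n x h => [|n IH] x h /=; first by case: (x =P y) => [->//|_]; rewrite eqxx.
move=> S0 xi; have [x' _ ] : exists2 x' : sequence, true & fill_prob (probs theta x h)
    (select (probs theta x h) x) x x' *
    sample_prob theta n x' (next_carry theta x h) y != 0.
  apply/exists_inP; apply: contraR S0 => /exists_inPn H; apply/eqP/big1 => x' _.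
  by apply/eqP/negPn/H.
rewrite mulf_eq0 negb_or => /andP[+ sx'].
rewrite /fill_prob; case: ifP; last by rewrite eqxx.
move=> /forallP/(_ i)/implyP agree _.
have iS : i \notin select (probs theta x h) x.
  by apply: contra xi => /(fintype.subsetP (select_masked _ _)); rewrite inE.
by rewrite -(eqP (agree iS)); apply: IH sx' _; rewrite (eqP (agree iS)).
Qed.

Definition fill_weight theta y (s : sequence * carry) : R :=
  \prod_(i in select (probs theta s.1 s.2) s.1) probs theta s.1 s.2 i (val y i).

(** Among the possible next sequences only the teacher-forced one can lead to [y], so the sum over
    paths collapses to one product. The last factor tests whether [n] steps end in [y]. *)
Lemma sample_probE theta n x h y :
  sample_prob theta n x h (val y) =
  (\prod_(k < n) fill_weight theta y (iter k (tf_step theta (val y)) (x, h))) *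
  ((iter n (tf_step theta (val y)) (x, h)).1 == val y)%:R.
Proof.
elim: n x h => [|n IH] x h; first by rewrite big_ord0 mul1r.
rewrite big_ord_recl iterSr [LHS]/=.
set p := probs theta x h; set S := select p x.
pose z : sequence := [ffun i => if i \in S then val y i else x i].
rewrite (bigD1 z)// big1 => [|x' /= x'z]; last first.
  apply/eqP; rewrite mulf_eq0; apply/norP => -[fx' sx'].
  move/negP: x'z; apply; apply/eqP/ffunP => i; rewrite ffunE.
  move: fx'; rewrite /fill_prob; case: ifP; last by rewrite eqxx.
  move=> /forallP/(_ i)/implyP agree; case: ifPn => [iS|/agree/eqP//].
  (* The mask has probability 0, so the token drawn at [i] is not the mask; it then persists and
     must equal [val y i]. *)
  rewrite (bigD1 i)//= mulf_eq0 negb_or => /andP[pi _].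
  rewrite -(sample_prob_unmasked sx')//; apply: contra pi => /eqP ->.
  by rewrite /p probs_mask.
rewrite [LHS]addr0 IH mulrA; congr (_ * _ * _); last first.
  by apply: eq_bigr => k _; rewrite lift0 iterSr.
rewrite /fill_prob ifT; last first.
  by apply/forallP => i; apply/implyP => iS; rewrite ffunE (negbTE iS).
by apply: eq_bigr => i iS; rewrite ffunE iS.
Qed.

(** Unmasked positions agree with [y] at every step, and no mask is left after [num_steps] steps. *)
Lemma tf_seq_final theta y : tf_seq theta (val y) (num_steps M) = val y.
Proof.
have agree j i : tf_seq theta (val y) j i != Defs.mask M ->
    tf_seq theta (val y) j i = val y i.
  elim: j => [|j IH].
    rewrite ffunE; case: ifP => iO; first by rewrite eqxx.
    by have /forallP/(_ i) := valP y; rewrite iO => /eqP.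
  by rewrite /tf_seq /tf_state iterS -/(tf_state _ _ j) ffunE; case: ifP.
have := num_steps_stop theta y (num_steps M); rewrite leqnn cards_eq0 => /eqP M0.
apply/ffunP => i; apply: agree.
have : i \notin masked (tf_seq theta (val y) (num_steps M)) by rewrite M0 inE.
by rewrite inE.
Qed.

Lemma psampleE theta y : psample M theta y =
  \prod_(j < num_steps M) \prod_(i in tf_select theta (val y) j)
    probs theta (tf_seq theta (val y) j) (tf_carry theta (val y) j) i (val y i).
Proof.
rewrite /psample sample_probE.
rewrite -[iter (num_steps M) _ _]/(tf_state theta (val y) (num_steps M)).
by rewrite -[(tf_state _ _ _).1]/(tf_seq _ _ _) tf_seq_final eqxx mulr1.
Qed.

Lemma psample_gt0 theta y : 0 < psample M theta y.
Proof.
rewrite psampleE; apply: prodr_gt0 => j _; apply: prodr_gt0 => i _.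
by apply: probs_gt0 => //; exact: response_neq_mask.
Qed.

Lemma ln_prod (I : finType) (P : pred I) (F : I -> R) :
  (forall i, P i -> 0 < F i) -> ln (\prod_(i | P i) F i) = \sum_(i | P i) ln (F i).
Proof.
move=> F0; suff [] : 0 < \prod_(i | P i) F i /\
    ln (\prod_(i | P i) F i) = \sum_(i | P i) ln (F i) by [].
elim/big_ind2 : _ => [|x1 x2 y1 y2 [x0 <-] [y0 <-]|i /F0 Fi]; first by rewrite ln1.
  by rewrite mulr_gt0// lnM.
by split.
Qed.

Lemma ln_psample theta y : - ln (psample M theta y) =
  \sum_(j < num_steps M) cross_entropy (val y) (tf_seq theta (val y) j)
    (tf_select theta (val y) j) theta (tf_carry theta (val y) j).
Proof.
have pos j i : 0 < probs theta (tf_seq theta (val y) j) (tf_carry theta (val y) j) i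
    (val y i) by apply: probs_gt0 => //; exact: response_neq_mask.
rewrite psampleE ln_prod => [|j _]; last exact: prodr_gt0.
rewrite -sumrN; apply: eq_bigr => j _.
by rewrite ln_prod// -sumrN.
Qed.

(** The first summand is the negative entropy of [pstar], independent of [theta]; positivity of
    [psample] keeps the divergence finite. *)
Lemma KL_psample theta : KL (@pstar R M) (psample M theta) =
  (\sum_(y : response M) pstar y * ln (pstar y) + loss_revealed M theta)%:E.
Proof.
have [p0 _] := pstar_distr M.
rewrite /KL /loss_revealed -big_split/=.
rewrite (eq_bigr (fun y : response M =>
  (pstar y * ln (pstar y / psample M theta y))%:E)); last first.
  by move=> y _; rewrite gt_eqF ?psample_gt0.
rewrite sumEFin big_mkcond/=; congr EFin; apply: eq_bigr => y _.
have := p0 y; rewrite le_eqVlt => /orP[/eqP <-|py].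
  by rewrite ltxx !mul0r addr0.
by rewrite py -mulrDr -ln_psample ln_div// posrE psample_gt0.
Qed.

(** Supplies the lower bound that makes [inf] of the loss a genuine infimum. *)
Lemma loss_revealed_ge0 theta : 0 <= loss_revealed M theta.
Proof.
have [p0 _] := pstar_distr M.
apply: sumr_ge0 => y _; rewrite mulr_ge0//; apply: sumr_ge0 => j _.
by apply: sumr_ge0 => i _; rewrite oppr_ge0 ln_le0// probs_le1.
Qed.

End Sampler.

(** * Truncation error *)

Lemma geometric_tail {R : realType} (gamma : R) a b : 0 <= gamma < 1 ->
  \sum_(a <= r < b) gamma ^+ r <= gamma ^+ a / (1 - gamma).
Proof.
move=> /andP[g0 g1]; have g1' : 0 < 1 - gamma by rewrite subr_gt0.
have [ab|ba] := leqP a b; last first.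
  by rewrite big_geq ?(ltnW ba)// divr_ge0 ?exprn_ge0// ltW.
rewrite ler_pdivlMr//.
suff -> : (\sum_(a <= r < b) gamma ^+ r) * (1 - gamma) = gamma ^+ a - gamma ^+ b.
  by rewrite gerBl exprn_ge0.
rewrite mulr_suml.
(* After multiplication by [1 - gamma] the sum telescopes. *)
transitivity (\sum_(a <= r < b) (- gamma ^+ r.+1 - - gamma ^+ r)).
  by apply: eq_bigr => r _; rewrite exprSr opprK mulrBr mulr1 addrC.
by rewrite (telescope_sumr (fun r => - gamma ^+ r))// opprK addrC.
Qed.

(** The first window contributes nothing, as [j %% W = j] there. In each later window the step at
    offset [i] has a tail of at most [gamma ^+ i / (1 - gamma)], and these sum to at most
    [1 / (1 - gamma) ^+ 2]. *)
Lemma window_tails {R : realType} (gamma : R) W N : 0 <= gamma < 1 -> (0 < W)%N ->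
  \sum_(0 <= j < N.+1 * W) \sum_(j %% W <= r < j) gamma ^+ r <=
  N%:R / (1 - gamma) ^+ 2.
Proof.
move=> g01 W0; have /andP[g0 g1] := g01.
have g1' : 0 < 1 - gamma by rewrite subr_gt0.
elim: N => [|N IH].
  rewrite mul0r mul1n big_nat_cond big1// => j /andP[/andP[_ jW] _].
  by rewrite modn_small// big_geq.
rewrite (@big_cat_nat _ _ _ (N.+1 * W))//=; last by rewrite leq_mul2r leqnSn orbT.
rewrite -natr1 mulrDl lerD// -{1}[(N.+1 * W)%N]add0n big_addn.
have -> : (N.+2 * W - N.+1 * W = W)%N by rewrite -mulnBl subSnn mul1n.
apply: (@le_trans _ _ (\sum_(0 <= i < W) gamma ^+ i / (1 - gamma))).
  rewrite big_nat_cond [leRHS]big_nat_cond; apply: ler_sum => i /andP[/andP[_ iW] _].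
  by rewrite addnC modnMDl modn_small//; exact: geometric_tail.
rewrite -mulr_suml expr2 invfM mul1r ler_wpM2r ?invr_ge0 ?(ltW g1')//.
by apply: le_trans (geometric_tail _ _ g01) _; rewrite expr0 mul1r.
Qed.

Lemma linear_rowE {R : realType} n (f : 'rV[R]_n -> R) (g : 'rV[R]_n) :
  linear (f : 'rV[R]_n -> R^o) -> f g = \sum_k g 0 k * f (delta_mx 0 k).
Proof.
move=> lf; pose fM := GRing.isLinear.Build _ _ _ _ _ lf.
pose fL : {linear 'rV[R]_n -> R^o} := HB.pack (f : 'rV[R]_n -> R^o) fM.
rewrite [in LHS](row_sum_delta g) -[LHS]/(fL _) linear_sum.
by apply: eq_bigr => k _; rewrite linearZ.
Qed.

Section GradientBound.
Context {R : realType} (M : model R).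
Local Notation param := 'rV[R]_(nparam M).
Local Notation carry := 'M[R]_(len M, width M).
Variables (gamma Ch CL : R) (W : nat) (theta : param).
Hypothesis denoiser : denoiser_assumption M.
Hypothesis contractive : contractive_carry M gamma Ch CL.
Implicit Types (y : response M) (v : param).

(** The constants dominate operator norms, which are nonnegative, at step 0 of some response in the
    support; such a response exists since [pstar] sums to 1. *)
Lemma contractive_ge0 : (0 < num_steps M)%N ->
  [/\ 0 <= gamma, gamma < 1, 0 <= Ch & 0 <= CL].
Proof.
move=> J0; have [g1 cc] := contractive; have [p0 p1] := pstar_distr M.
have [y py] : exists y : response M, 0 < pstar y.
  apply/existsP; apply: contraT => /existsPn H.
  have : \sum_(y : response M) pstar y = 0.
    by apply: big1 => y _; apply/eqP; rewrite eq_le p0 andbT leNgt.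
  by rewrite p1 => /eqP; rewrite oner_eq0.
have [Hg HCh HCL] := cc theta y py 0%N J0.
split=> //; first exact: le_trans (opnorm_mx_spec _).1 Hg.
  exact: le_trans (opnorm_mx_spec _).1 HCh.
exact: le_trans (opnorm_form_spec _).1 HCL.
Qed.

Lemma carry_jacobian_le y j r w : 0 < pstar y -> (r <= j <= num_steps M)%N ->
  l2norm (carry_jacobian theta (val y) j r.+1 w) <= gamma ^+ r * l2norm w.
Proof.
move=> py; elim: r j => [|r IH] j; first by rewrite carry_jacobian1 expr0 mul1r.
case: j => // j /andP[rj jJ]; rewrite carry_jacobianSS /=.
have [_ cc] := contractive; have [Hg _ _] := cc theta y py j jJ.
have [g0 _ _ _] := contractive_ge0 (leq_ltn_trans (leq0n _) jJ).
apply: le_trans ((opnorm_mx_spec _).2 _) _; rewrite exprS -mulrA.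
rewrite (@le_trans _ _ (gamma * l2norm (carry_jacobian theta (val y) j r.+1 w)))//.
  by rewrite ler_wpM2r// l2norm_ge0.
by rewrite ler_wpM2l// IH// -ltnS rj ltnW.
Qed.

(** A delay of [r.+1] passes through [r] carry Jacobians, one parameter derivative and one loss
    derivative. *)
Lemma backprop_loss_le y j r v : 0 < pstar y -> (r < j < num_steps M)%N ->
  `|dloss_dh theta (val y) j (backprop theta (val y) j r.+1 v)| <=
  CL * Ch * gamma ^+ r * l2norm v.
Proof.
move=> py /andP[rj jJ].
have [g0 g1 Ch0 CL0] := contractive_ge0 (leq_ltn_trans (leq0n _) jJ).
have [_ cc] := contractive.
have [_ _ HCL] := cc theta y py j jJ.
have jrJ : (j - r.+1 < num_steps M)%N by apply: leq_ltn_trans jJ; exact: leq_subr.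
have [_ HCh _] := cc theta y py _ jrJ.
apply: le_trans ((opnorm_form_spec _).2 _) _.
apply: (@le_trans _ _ (CL * l2norm (backprop theta (val y) j r.+1 v))).
  by rewrite ler_wpM2r// l2norm_ge0.
rewrite -!mulrA ler_wpM2l//.
have jb : (r <= j <= num_steps M)%N by rewrite (ltnW rj) (ltnW jJ).
apply: le_trans (carry_jacobian_le _ py jb) _; rewrite mulrCA ler_wpM2l ?exprn_ge0//.
apply: le_trans ((opnorm_mx_spec _).2 _) _.
by rewrite ler_wpM2r// l2norm_ge0.
Qed.

(** Derivative terms whose delay reaches back beyond the start of the window: full gradient minus
    truncated one, as a linear form. *)
Definition truncation_error v : R :=
  \sum_(y : response M) pstar y * \sum_(j < num_steps M)
    \sum_((j %% W).+1 <= r < j.+1)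
      dloss_dh theta (val y) j (backprop theta (val y) j r v).

Lemma truncation_error_linear : linear (truncation_error : param -> R^o).
Proof.
move=> a u v; rewrite -[RHS]/(a * truncation_error u + truncation_error v).
rewrite /truncation_error mulr_sumr -big_split/=.
apply: eq_bigr => y _; rewrite mulrCA -mulrDr; congr (_ * _).
rewrite mulr_sumr -big_split/=; apply: eq_bigr => j _.
rewrite mulr_sumr -big_split/=; apply: eq_bigr => r _.
by rewrite backprop_linear {1}/dloss_dh linearP.
Qed.

Hypothesis W_gt0 : (0 < W)%N.
Hypothesis W_dvd : (W %| num_steps M)%N.
Hypothesis reg : regular M theta.
Hypothesis trunc0 : truncated_gradient M W theta = 0.
Hypothesis dL : differentiable (loss_inf M : param -> R^o) theta.

Lemma gradient_truncation_error k :
  gradient (loss_inf M) theta 0 k = truncation_error (delta_mx 0 k).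
Proof.
transitivity (gradient (loss_inf M) theta 0 k - truncated_gradient M W theta 0 k).
  by rewrite trunc0 [X in _ - X]mxE subr0.
rewrite /gradient /truncated_gradient !mxE.
rewrite (diff_loss_inf denoiser reg _ dL) (diff_frozen_loss denoiser theta _).2.
rewrite -sumrB; apply: eq_bigr => y _; rewrite -mulrBr; congr (_ * _).
rewrite -sumrB; apply: eq_bigr => j _.
rewrite (@big_cat_nat _ _ _ (j %% W).+1)//=; last by rewrite ltnS leq_mod.
by rewrite opprD addrACA subrr add0r addrAC subrr add0r.
Qed.

(** The coordinates of [g] are the values of [truncation_error] on the basis, so evaluating this
    linear form at [g] itself gives the squared norm. *)
Lemma gradient_l2norm_sqr (g := gradient (loss_inf M) theta) :
  l2norm g ^+ 2 = truncation_error g.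
Proof.
rewrite (linear_rowE _ truncation_error_linear) l2norm_sqr big_ord1.
by apply: eq_bigr => k _; rewrite -gradient_truncation_error.
Qed.

Lemma gradient_bound :
  l2norm (gradient (loss_inf M) theta) ^+ 2 <=
  (CL * Ch / (1 - gamma) ^+ 2 * ((num_steps M)%:R / W%:R - 1)) ^+ 2.
Proof.
set g := gradient _ _.
(* With no steps the gradient is an empty sum; otherwise step 0 exists and gives the signs of the
   constants. *)
have [J0|J0] := posnP (num_steps M).
  rewrite gradient_l2norm_sqr /truncation_error big1 ?sqr_ge0// => y _.
  by rewrite J0 big_ord0 mulr0.
have [g0 g1 Ch0 CL0] := contractive_ge0 J0.
have g1' : 0 < 1 - gamma by rewrite subr_gt0.
have [N JE] : exists N, num_steps M = (N.+1 * W)%N.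
  move/dvdnP: W_dvd => [[|N] JE]; last by exists N.
  by rewrite JE mul0n in J0.
have -> : (num_steps M)%:R / W%:R - 1 = N%:R :> R.
  by rewrite JE natrM mulfK ?pnatr_eq0 ?gtn_eqF// -addn1 natrD addrK.
have [p0 p1] := pstar_distr M.
set B := CL * Ch / _ ^+ 2.
(* [N] counts the windows after the first; dividing this estimate by a nonzero [l2norm g] gives the
   claim. *)
have key : l2norm g ^+ 2 <= B * N%:R * l2norm g.
  rewrite gradient_l2norm_sqr -/g.
  apply: (@le_trans _ _ (\sum_(y : response M) pstar y * (B * N%:R * l2norm g))); last first.
    by rewrite -mulr_suml p1 mul1r.
  apply: ler_sum => y _.
  have := p0 y; rewrite le_eqVlt => /orP[/eqP <-|py]; first by rewrite !mul0r.
  rewrite ler_wpM2l//.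
  apply: (@le_trans _ _ (\sum_(j < num_steps M) \sum_(j %% W <= r < j)
      CL * Ch * gamma ^+ r * l2norm g)).
    apply: ler_sum => j _; rewrite big_add1/= big_nat_cond [leRHS]big_nat_cond.
    apply: ler_sum => r /andP[/andP[_ rj] _]; apply: le_trans (ler_norm _) _.
    by apply: backprop_loss_le => //; rewrite rj ltn_ord.
  under eq_bigr do under eq_bigr do rewrite mulrAC.
  under eq_bigr do rewrite -mulr_sumr.
  rewrite -mulr_sumr -(big_mkord xpredT (fun j => \sum_(j %% W <= r < j) gamma ^+ r)).
  have g01 : 0 <= gamma < 1 by rewrite g0.
  have := window_tails N g01 W_gt0; rewrite -JE => tails.
  have C0 : 0 <= CL * Ch * l2norm g by rewrite !mulr_ge0 ?l2norm_ge0.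
  apply: le_trans (ler_wpM2l C0 tails) _.
  by rewrite /B (mulrC N%:R) [leLHS]mulrAC !mulrA.
have B0 : 0 <= B * N%:R.
  by apply: mulr_ge0 => //; apply: divr_ge0; [exact: mulr_ge0|exact: sqr_ge0].
rewrite lerXn2r ?nnegrE ?l2norm_ge0//.
have [->//|gn0] := eqVneq (l2norm g) 0.
have g_gt0 : 0 < l2norm g by rewrite lt_neqAle eq_sym gn0 l2norm_ge0.
by rewrite -(ler_pM2r g_gt0) -expr2.
Qed.

End GradientBound.

(** * The bound on the KL gap and its behaviour in the window length *)

Theorem theorem1 (R : realType) (M : model R) (gamma Ch CL mu : R) (W : nat)
    (thetaW : 'rV[R]_(nparam M)) :
  denoiser_assumption M ->
  contractive_carry M gamma Ch CL ->
  (forall theta, loss_inf M theta = loss_revealed M theta) ->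
  (1 <= W)%N -> (W %| num_steps M)%N ->
  regular M thetaW ->
  truncated_gradient M W thetaW = 0 ->
  0 < mu ->
  PL_at M mu thetaW ->
  [/\ (KL (@pstar R M) (psample M thetaW)
         - ereal_inf (range (fun theta => KL (@pstar R M) (psample M theta)))
       <= (truncation_bound M gamma Ch CL mu W)%:E)%E,
      (forall W1 W2 : nat, (1 <= W1)%N -> (W1 <= W2)%N ->
         (W1 %| num_steps M)%N -> (W2 %| num_steps M)%N ->
         truncation_bound M gamma Ch CL mu W2
           <= truncation_bound M gamma Ch CL mu W1),
      (CL * Ch != 0 -> (0 < num_steps M)%N ->
       forall W1 W2 : nat, (1 <= W1)%N -> (W1 < W2)%N ->
         (W1 %| num_steps M)%N -> (W2 %| num_steps M)%N ->
         truncation_bound M gamma Ch CL mu W2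
           < truncation_bound M gamma Ch CL mu W1) &
      (W = num_steps M -> truncation_bound M gamma Ch CL mu W = 0)].
Proof.
move=> denoiser contractive lossE W0 WJ reg trunc0 mu0 [dL PL].
have ratio W1 : (0 < W1)%N -> (W1 %| num_steps M)%N -> (0 < num_steps M)%N ->
    0 <= (num_steps M)%:R / W1%:R - 1 :> R.
  move=> W10 W1J J0; rewrite subr_ge0 ler_pdivlMr ?ltr0n// mul1r ler_nat.
  exact: dvdn_leq.
have mu2 : 0 < 2 * mu by rewrite mulr_gt0.
split.
- have lossinf_ge : forall theta, inf (range (loss_inf M)) <= loss_inf M theta.
    move=> theta; apply: ge_inf; last by exists theta.
    by exists 0 => _ [t _ <-]; rewrite lossE loss_revealed_ge0.
  set H : R := \sum_(y : response M) pstar y * ln (pstar y).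
  have KLE theta : KL (@pstar R M) (psample M theta) = (H + loss_inf M theta)%:E.
    by rewrite KL_psample// lossE.
  apply: (@le_trans _ _ ((loss_inf M thetaW - inf (range (loss_inf M)))%:E)).
    have -> : (loss_inf M thetaW - inf (range (loss_inf M)))%:E =
        (KL (@pstar R M) (psample M thetaW) - (H + inf (range (loss_inf M)))%:E)%E.
      by rewrite KLE -EFinB opprD addrACA subrr add0r.
    (* The subtracted infimum is bounded below by [H] plus the infimum of the loss, since each
       divergence is [H] plus a loss value. *)
    apply: leeB => //; apply/ereal_infP => _ [theta _ <-].
    by rewrite KLE lee_fin lerD2l.
  rewrite lee_fin /truncation_bound.
  have gb := gradient_bound denoiser contractive W0 WJ reg trunc0 dL.
  rewrite -(ler_pM2l mu0); apply: le_trans PL _.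
  have mulE (b r : R) : mu * (b ^+ 2 / (2 * mu) * r ^+ 2) = 2^-1 * (b * r) ^+ 2.
    rewrite exprMn [LHS]mulrA [RHS]mulrA; congr (_ * _).
    by rewrite mulrCA invfM (mulrCA mu) divff ?gt_eqF// mulr1 [LHS]mulrC.
  by rewrite mulE ler_wpM2l// invr_ge0.
- move=> W1 W2 W10 W12 W1J W2J; rewrite /truncation_bound.
  rewrite ler_wpM2l ?divr_ge0 ?sqr_ge0 ?(ltW mu2)//.
  have W20 := leq_trans W10 W12.
  (* Without steps the ratio is 0 for both window lengths, so the two bounds are equal; otherwise
     [ratio] makes both bases nonnegative and squaring is monotone. *)
  have [->|J0] := posnP (num_steps M); first by rewrite !mul0r.
  rewrite lerXn2r ?nnegrE ?ratio// lerB// ler_wpM2l//.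
  by rewrite lef_pV2 ?posrE ?ltr0n// ler_nat.
- move=> CC J0 W1 W2 W10 W12 W1J W2J; rewrite /truncation_bound.
  have W20 := ltn_trans W10 W12.
  have [_ g1 _ _] := contractive_ge0 thetaW contractive J0.
  rewrite ltr_pM2l; last first.
    rewrite divr_gt0// exprn_even_gt0//= mulf_neq0// invr_eq0 expf_neq0//.
    by rewrite gt_eqF// subr_gt0.
  rewrite ltrXn2r// ?ratio// ltrD2r ltr_pM2l ?ltr0n//.
  by rewrite ltf_pV2 ?posrE ?ltr0n// ltr_nat.
- move=> WE; rewrite /truncation_bound -WE divff ?subrr ?expr0n ?mulr0//.
  by rewrite pnatr_eq0 -lt0n.
Qed.
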